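(* Let $R$ be a um-ring (commutative with nonzero identity), $M$ and $F$ $R$-modules, and let $\phi:S(M)\to S(M)\cup\{\emptyset\}$ and $\tilde\phi:S(F\otimes M)\to S(F\otimes M)\cup\{\emptyset\}$ be functions. Suppose that $N$ is a proper submodule of $M$ such that $F\otimes\phi(N)=\tilde\phi(F\otimes N)$. (1) If $F$ is a flat $R$-module and $N$ is a $\phi$-classical 1-absorbing prime submodule of $M$ such that $F\otimes N\neq F\otimes M$, then $F\otimes N$ is a $\tilde\phi$-classical 1-absorbing prime submodule of $F\otimes M$. (2) Suppose that $F$ is a faithfully flat $R$-module. Then $N$ is a $\phi$-classical 1-absorbing prime submodule of $M$ if and only if $F\otimes N$ is a $\tilde\phi$-classical 1-absorbing prime submodule of $F\otimes M$.
   Context: All modules are unitary, and $\otimes=\otimes_R$. $S(X)$ is the set of all submodules of an $R$-module $X$. Standing assumption: $\phi(L)\subseteq L$ for every submodule $L$ (and likewise for $\tilde\phi$). For $F$ flat and $L$ a submodule of $M$, $F\otimes L$ is regarded as a submodule of $F\otimes M$; $F\otimes\emptyset$ means $\emptyset$. A um-ring is a ring $R$ such that every $R$-module which is equal to a finite union of submodules is equal to one of them. For a function $\phi:S(X)\to S(X)\cup\{\emptyset\}$, a proper submodule $N$ of an $R$-module $X$ is $\phi$-classical 1-absorbing prime if whenever $a,b,c\in R$ are nonunits and $m\in X$ with $abcm\in N\setminus\phi(N)$, then $abm\in N$ or $cm\in N$. *)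

(* Defs.v *)
From HB Require Import structures.
From mathcomp Require Import all_boot all_order all_algebra.
From mathcomp Require Import boolp classical_sets.
From mathcomp.multinomials Require Import freeg.

Set Implicit Arguments.
Unset Strict Implicit.
Unset Printing Implicit Defensive.

Import GRing.Theory.
Local Open Scope ring_scope.
Local Open Scope quotient_scope.

(* Submodules of X are the elements of the library type [submodClosed X]
   (boolean predicates closed under 0, + and scaling). Classically every subset
   is a boolean predicate, and [submod_ext] shows that Leibniz equality on
   [submodClosed X] is equality of subsets, so [submodClosed X] is S(X). *)
Section Submodules.
Variables (R : comUnitRingType) (X : lmodType R).

Lemma submod_ext (K L : submodClosed X) : K =i L -> K = L.
Proof.
case: K L => [K [[hK] [sK]]] [L [[hL] [sL]]] /= eqKL.
have {}eqKL : K = L by apply/funext => x; exact: eqKL.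
case: _ / eqKL in hL sL *.
by rewrite (Prop_irrelevance hK hL) (Prop_irrelevance sK sL).
Qed.

Definition submod_of_pred (P : {pred X}) (hP : submod_closed P) : submodClosed X :=
  HB.pack P (GRing.isSubmodClosed.Build R X P hP).

Definition proper_submod (N : submodClosed X) : Prop := ~ forall x, x \in N.

Lemma submod_closedP (L : submodClosed X) : submod_closed L.
Proof. by split=> [|a x y xL yL]; rewrite ?rpred0 ?rpredD ?rpredZ. Qed.

Definition span_pred (A : set X) : {pred X} :=
  fun x => `[< forall L : submodClosed X, (forall y, A y -> y \in L) -> x \in L >].

Lemma span_closed A : submod_closed (span_pred A).
Proof.
split=> [|a x y /asboolP hx /asboolP hy]; apply/asboolP => L hL.
  exact: rpred0.
by rewrite rpredD ?rpredZ ?hx ?hy.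
Qed.

Definition span_submod (A : set X) : submodClosed X :=
  submod_of_pred (span_closed A).

Lemma span_submodP A x :
  reflect (forall L : submodClosed X, (forall y, A y -> y \in L) -> x \in L)
          (x \in span_submod A).
Proof. exact: asboolP. Qed.

Lemma mem_span_submod (A : set X) x : A x -> x \in span_submod A.
Proof. by move=> Ax; apply/span_submodP => L; apply. Qed.

Record submod_type (L : submodClosed X) := SubmodElt {
  submod_val : X;
  submod_valP : submod_val \in L
}.

HB.instance Definition _ (L : submodClosed X) :=
  [isSub for @submod_val L].
HB.instance Definition _ (L : submodClosed X) :=
  [Choice of submod_type L by <:].
HB.instance Definition _ (L : submodClosed X) :=
  GRing.SubChoice_isSubLmodule.Build R X (fun x => x \in L) (submod_type L)
    (submod_closedP L).

Definition submod_incl (L : submodClosed X) : {linear submod_type L -> X} :=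
  GRing.Linear.clone _ _ _ _ (val : submod_type L -> X) _.

Lemma submod_zmod_closed (L : submodClosed X) : zmod_closed L.
Proof.
by split=> [|x y xL yL]; rewrite ?rpred0 // -scaleN1r rpredD ?rpredZ.
Qed.

Definition submod_zmod (L : submodClosed X) : zmodClosed X :=
  HB.pack (L : {pred X})
    (GRing.isZmodClosed.Build X (L : {pred X}) (submod_zmod_closed L)).

Definition quot_mod (L : submodClosed X) : Type := Quotient.quot (submod_zmod L).

Section QuotientModule.
Variable L : submodClosed X.

HB.instance Definition _ := GRing.Zmodule.on (quot_mod L).

Definition quot_pi (x : X) : quot_mod L := \pi_(Quotient.quot (submod_zmod L)) x.
Definition quot_repr (u : quot_mod L) : X :=
  repr (u : Quotient.quot (submod_zmod L)).

Lemma quot_reprK u : quot_pi (quot_repr u) = u.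
Proof. exact: reprK. Qed.

Lemma quot_piP x y : quot_pi x = quot_pi y <-> x - y \in L.
Proof.
change (x - y \in L) with (x - y \in submod_zmod L).
rewrite Quotient.idealrBE; split=> [e|/eqP e]; [exact/eqP|exact: e].
Qed.

Lemma quot_piD x y : quot_pi (x + y) = quot_pi x + quot_pi y.
Proof. exact: Quotient.pi_add. Qed.

Definition quot_scale (a : R) (u : quot_mod L) := quot_pi (a *: quot_repr u).

Lemma quot_piZ a x : quot_scale a (quot_pi x) = quot_pi (a *: x).
Proof.
by apply/quot_piP; rewrite -scalerBr rpredZ //; apply/quot_piP/quot_reprK.
Qed.

Lemma quot_scaleA a b u : quot_scale a (quot_scale b u) = quot_scale (a * b) u.
Proof. by rewrite -[u]quot_reprK !quot_piZ scalerA. Qed.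

Lemma quot_scale1 : left_id 1 quot_scale.
Proof. by move=> u; rewrite -[u]quot_reprK quot_piZ scale1r. Qed.

Lemma quot_scaleDr : right_distributive quot_scale +%R.
Proof.
move=> a u v; rewrite -[u]quot_reprK -[v]quot_reprK -quot_piD !quot_piZ.
by rewrite scalerDr quot_piD.
Qed.

Lemma quot_scaleDl u : {morph quot_scale^~ u : a b / a + b}.
Proof. by move=> a b; rewrite -[u]quot_reprK !quot_piZ scalerDl quot_piD. Qed.

HB.instance Definition _ := GRing.Zmodule_isLmodule.Build R (quot_mod L)
  quot_scaleA quot_scale1 quot_scaleDr quot_scaleDl.

Lemma quot_pi_is_linear : linear quot_pi.
Proof. by move=> a x y; rewrite quot_piD -quot_piZ. Qed.

HB.instance Definition _ :=
  GRing.isLinear.Build R X (quot_mod L) *:%R quot_pi quot_pi_is_linear.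

End QuotientModule.
End Submodules.

Section Image.
Variables (R : comUnitRingType) (X Y : lmodType R) (h : {linear X -> Y}).

Definition image_pred : {pred Y} := fun y => `[< exists x, h x = y >].

Lemma image_closed : submod_closed image_pred.
Proof.
split=> [|a y z /asboolP[x <-] /asboolP[x' <-]]; apply/asboolP.
  by exists 0; rewrite linear0.
by exists (a *: x + x'); rewrite linearP.
Qed.

Definition image_submod : submodClosed Y := submod_of_pred image_closed.

Lemma image_submodP y : reflect (exists x, h x = y) (y \in image_submod).
Proof. exact: asboolP. Qed.

End Image.

(* F (x) M is the quotient of the free R-module on F * M by the submodule
   spanned by the bilinearity relations. *)
Section Tensor.
Variables (R : comUnitRingType) (F M : lmodType R).

Local Notation free := ({freeg (F * M)%type / R}).

Inductive tensor_relation : free -> Prop :=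
| tensor_relDl x x' m :
    tensor_relation (<< (x + x', m) >> - (<< (x, m) >> + << (x', m) >>))
| tensor_relDr x m m' :
    tensor_relation (<< (x, m + m') >> - (<< (x, m) >> + << (x, m') >>))
| tensor_relZl a x m :
    tensor_relation (<< (a *: x, m) >> - a *: << (x, m) >>)
| tensor_relZr a x m :
    tensor_relation (<< (x, a *: m) >> - a *: << (x, m) >>).

Definition tensor_rel_submod : submodClosed free := span_submod tensor_relation.

Definition tensor : Type := quot_mod tensor_rel_submod.

HB.instance Definition _ := GRing.Lmodule.on tensor.

Definition tens (x : F) (m : M) : tensor := quot_pi tensor_rel_submod << (x, m) >>.

Definition bilin (V : lmodType R) (f : F -> M -> V) : Prop :=
  (forall m, linear (f^~ m)) /\ (forall x, linear (f x)).

Lemma tens_bilin : bilin tens.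
Proof.
have relP u v : tensor_relation (u - v) ->
    quot_pi tensor_rel_submod u = quot_pi tensor_rel_submod v.
  by move=> h; apply/quot_piP/mem_span_submod.
have piZ a u : quot_pi tensor_rel_submod (a *: u) = a *: quot_pi tensor_rel_submod u.
  exact: linearZ_LR.
split=> [m a x y|x a m n]; rewrite /tens -piZ.
  by rewrite (relP _ _ (tensor_relDl _ _ _)) quot_piD (relP _ _ (tensor_relZl _ _ _)).
by rewrite (relP _ _ (tensor_relDr _ _ _)) quot_piD (relP _ _ (tensor_relZr _ _ _)).
Qed.

Section Lift.
Variables (V : lmodType R) (f : F -> M -> V).

Definition tensor_lift (t : tensor) : V :=
  fglift (fun p : F * M => f p.1 p.2) (quot_repr t).

Local Notation flift := (fglift (fun p : F * M => f p.1 p.2)).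

Lemma flift_linear : linear flift.
Proof.
pose h : {additive free -> V} := HB.pack flift
  (GRing.isZmodMorphism.Build free V flift
    (lift_is_additive (fun p : F * M => f p.1 p.2))).
have hU c z : h << c *g z >> = c *: f z.1 z.2 by exact: liftU.
have hZ a D : h (a *: D) = a *: h D.
  rewrite -[D]freeg_sumE scaler_sumr !(raddf_sum h) scaler_sumr.
  apply: eq_bigr => z _.
  suff -> : a *: << coeff z D *g z >> = << a * coeff z D *g z >> :> free.
    by rewrite !hU scalerA.
  by apply/eqP/freeg_eqP => y; rewrite coeffZ !coeffU mulrA.
by move=> a D D'; rewrite -[flift _]/(h _) (raddfD h) hZ.
Qed.

Hypothesis f_bilin : bilin f.

Lemma flift_pi D : tensor_lift (quot_pi tensor_rel_submod D) = flift D.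
Proof.
pose g : {linear free -> V} :=
  HB.pack flift (GRing.isLinear.Build R free V *:%R flift flift_linear).
have [fl fr] := f_bilin.
have fDl x y m : f (x + y) m = f x m + f y m by have := fl m 1 x y; rewrite !scale1r.
have fDr x m n : f x (m + n) = f x m + f x n by have := fr x 1 m n; rewrite !scale1r.
have f0l m : f 0 m = 0 by apply: (addrI (f 0 m)); rewrite -fDl !addr0.
have f0r x : f x 0 = 0 by apply: (addrI (f x 0)); rewrite -fDr !addr0.
have fZl a x m : f (a *: x) m = a *: f x m by have := fl m a x 0; rewrite f0l !addr0.
have fZr a x m : f x (a *: m) = a *: f x m by have := fr x a m 0; rewrite f0r !addr0.
have ker_closed : submod_closed (fun D => g D == 0).
  split=> [|a u v]; rewrite !unfold_in ?linear0 // => /eqP gu /eqP gv.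
  by rewrite linearP gu gv scaler0 addr0.
have gU x m : g << (x, m) >> = f x m by rewrite /= liftU scale1r.
apply/eqP; rewrite -subr_eq0 -[flift D]/(g D) -[tensor_lift _]/(g _) -linearB.
have /quot_piP/span_submodP/(_ (submod_of_pred ker_closed)) := quot_reprK (quot_pi tensor_rel_submod D).
apply=> u hu; suff gu0 : g u = 0 by exact/eqP.
by case: hu => *; rewrite (linearB g) ?(linearD g) ?(linearZ_LR g) !gU
  ?fDl ?fDr ?fZl ?fZr subrr.
Qed.

Lemma tensor_lift_tens x m : tensor_lift (tens x m) = f x m.
Proof. by rewrite flift_pi liftU scale1r. Qed.

Lemma tensor_lift_linear : linear tensor_lift.
Proof.
move=> a t u; rewrite -[t]quot_reprK -[u]quot_reprK -linearP !flift_pi.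
exact: flift_linear.
Qed.

End Lift.

Lemma tensor_hom_ext (V : lmodType R) (g h : {linear tensor -> V}) :
  (forall x m, g (tens x m) = h (tens x m)) -> g =1 h.
Proof.
move=> e t; rewrite -[t]quot_reprK -[quot_repr t]freeg_sumE.
rewrite (linear_sum (quot_pi tensor_rel_submod)) !linear_sum; apply: eq_bigr => -[x m] _.
have -> : << coeff (x, m) (quot_repr t) *g (x, m) >> =
          coeff (x, m) (quot_repr t) *: << (x, m) >> :> free.
  by apply/eqP/freeg_eqP => y; rewrite coeffZ !coeffU mul1r.
by rewrite (linearZ_LR (quot_pi tensor_rel_submod)) !linearZ_LR; congr (_ *: _); exact: e.
Qed.

End Tensor.

Section TensorMap.
Variables (R : comUnitRingType) (F A B : lmodType R) (g : {linear A -> B}).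

Lemma tensor_map_bilin : bilin (fun (x : F) (a : A) => tens x (g a)).
Proof.
have [tl tr] := @tens_bilin R F B.
by split=> [a|x] c u v; rewrite ?linearP (tl, tr).
Qed.

Definition tensor_map : {linear tensor F A -> tensor F B} :=
  HB.pack (tensor_lift (fun (x : F) (a : A) => tens x (g a)))
    (GRing.isLinear.Build R (tensor F A) (tensor F B) *:%R _
      (tensor_lift_linear tensor_map_bilin)).

Lemma tensor_map_tens x a : tensor_map (tens x a) = tens x (g a).
Proof. exact: (tensor_lift_tens tensor_map_bilin). Qed.

End TensorMap.
Arguments tensor_map {R} F {A B} g.

Section Notions.
Variable R : comUnitRingType.

Definition exact_seq (A B C : lmodType R) (f : A -> B) (g : B -> C) : Prop :=
  forall y, g y = 0 <-> exists x, f x = y.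

Definition flat (F : lmodType R) : Prop :=
  forall (A B C : lmodType R) (f : {linear A -> B}) (g : {linear B -> C}),
    exact_seq f g -> exact_seq (tensor_map F f) (tensor_map F g).

Definition faithfully_flat (F : lmodType R) : Prop :=
  forall (A B C : lmodType R) (f : {linear A -> B}) (g : {linear B -> C}),
    exact_seq f g <-> exact_seq (tensor_map F f) (tensor_map F g).

(* For L a submodule of M, the submodule F (x) L of F (x) M: the image of the
   canonical map F (x) L -> F (x) M, which is injective when F is flat. *)
Definition tensor_submod (F M : lmodType R) (L : submodClosed M) :
    submodClosed (tensor F M) :=
  image_submod (tensor_map F (submod_incl L)).

Definition um_ring : Prop :=
  forall (X : lmodType R) (n : nat) (L : 'I_n -> submodClosed X),
    (forall x, exists i, x \in L i) -> exists i, forall x, x \in L i.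

(* A function phi : S(X) -> S(X) U {emptyset} is a function
   [submodClosed X -> option (submodClosed X)], with None for emptyset. *)
Definition in_opt (X : lmodType R) (o : option (submodClosed X)) (x : X) : bool :=
  if o is Some L then x \in L else false.

Definition contracting (X : lmodType R)
    (phi : submodClosed X -> option (submodClosed X)) : Prop :=
  forall (L : submodClosed X) (x : X), in_opt (phi L) x -> x \in L.

Definition classical_1abs_prime (X : lmodType R)
    (phi : submodClosed X -> option (submodClosed X)) (N : submodClosed X) : Prop :=
  proper_submod N /\
  forall (a b c : R) (m : X),
    a \isn't a GRing.unit -> b \isn't a GRing.unit -> c \isn't a GRing.unit ->
    (a * b * c) *: m \in N -> ~~ in_opt (phi N) ((a * b * c) *: m) ->
    (a * b) *: m \in N \/ c *: m \in N.

End Notions.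
Arguments tensor_submod {R} F {M} L.

(* Main.v *)
(** For nonunits a, b, c, the classical 1-absorbing condition says that the
    colon submodule (N : abc) is covered by (phi N : abc), (N : ab) and (N : c).
    Over a um-ring one of these three already contains (N : abc). Such an
    inclusion of colon submodules passes to F (x) N because a flat F satisfies
    F (x) (N : r) = (F (x) N : r), and it descends again when F is faithfully
    flat because then F (x) K <= F (x) L forces K <= L. *)
Require Import Defs.
From mathcomp Require Import all_boot all_order all_algebra.

Set Implicit Arguments.
Unset Strict Implicit.
Unset Printing Implicit Defensive.

Import GRing.Theory.
Local Open Scope ring_scope.

(** * Preimages, colon submodules and covers over a um-ring *)

Section Preimage.
Variables (R : comUnitRingType) (X Y : lmodType R) (h : {linear X -> Y}).

Lemma preim_submod_closed (L : submodClosed Y) :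
  submod_closed (fun x => h x \in L).
Proof.
have inE x : (x \in (fun x => h x \in L)) = (h x \in L) by [].
split=> [|a x y]; rewrite !inE ?linear0 ?rpred0 //.
by move=> hx hy; rewrite linearP rpredD ?rpredZ.
Qed.

Definition preim_submod (L : submodClosed Y) : submodClosed X :=
  submod_of_pred (preim_submod_closed L).

End Preimage.

Section Colon.
Variables (R : comUnitRingType) (X : lmodType R).

Definition colon (L : submodClosed X) (r : R) : submodClosed X :=
  preim_submod ( *:%R r) L.

Lemma mem_colon L r x : (x \in colon L r) = (r *: x \in L).
Proof. by []. Qed.

(** The um property is applied to [K] as a module in its own right, with each [L i] pulled back
    along the inclusion. *)
Lemma um_subset (K : submodClosed X) n (L : 'I_n -> submodClosed X) :
  um_ring R -> (forall x, x \in K -> exists i, x \in L i) ->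
  exists i, forall x, x \in K -> x \in L i.
Proof.
move=> um cover.
have [|i sub] := um _ n (fun i => preim_submod (submod_incl K) (L i)).
  by move=> x; have [i Li] := cover _ (submod_valP x); exists i.
by exists i => x Kx; exact: (sub (SubmodElt Kx)).
Qed.

(** The um property moves the choice of alternative in front of [m]: it depends on [a], [b], [c]
    only, so each alternative becomes an inclusion that can be tensored. *)
Lemma classical_1abs_primeP
    (phi : submodClosed X -> option (submodClosed X)) (N : submodClosed X) :
  um_ring R ->
  classical_1abs_prime phi N <->
  proper_submod N /\
  forall a b c : R,
    a \isn't a GRing.unit -> b \isn't a GRing.unit -> c \isn't a GRing.unit ->
    [\/ forall m, (a * b * c) *: m \in N -> in_opt (phi N) ((a * b * c) *: m),
        forall m, (a * b * c) *: m \in N -> (a * b) *: m \in N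
      | forall m, (a * b * c) *: m \in N -> c *: m \in N].
Proof.
move=> um; split=> -[properN primeN]; split=> // a b c; last first.
  move=> m ua ub uc Nm /negP phim.
  by have [/(_ m Nm)|/(_ m Nm)|/(_ m Nm)] := primeN a b c ua ub uc; auto.
move=> ua ub uc.
(* When phi N is empty, its slot in the covering is filled by (N : ab). *)
pose L0 := if phi N is Some P then colon P (a * b * c) else colon N (a * b).
pose L (i : 'I_3) :=
  if i == 0 then L0 else if i == 1 then colon N (a * b) else colon N c.
have cover m : m \in colon N (a * b * c) -> exists i, m \in L i.
  rewrite mem_colon => Nm.
  have [phim|phim] := boolP (in_opt (phi N) ((a * b * c) *: m)).
    by exists 0; rewrite /L /= /L0; case: (phi N) phim.
  by have [Nab|Nc] := primeN a b c m ua ub uc Nm phim; [exists 1|exists 2%:R].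
have [i] := um_subset um cover.
rewrite /L; case: (i == 0); last first.
  by case: (i == 1) => sub; [constructor 2|constructor 3] => m /sub.
rewrite /L0; case: (phi N) => [P|] sub; first by constructor 1 => m /sub.
by constructor 2 => m /sub.
Qed.

End Colon.

(** * Maps and submodules tensored with F *)

Section TensorSubmodules.
Variables (R : comUnitRingType) (F : lmodType R).

Lemma tens0r (M : lmodType R) (x : F) : tens x (0 : M) = 0.
Proof.
have [_ tr] := @tens_bilin R F M.
(* Linearity with coefficient -1 at 0 writes [tens x 0] as its own negative plus itself. *)
by have := tr x (-1) 0 0; rewrite scaler0 addr0 scaleN1r addNr.
Qed.

Lemma tensor_map_comp (A B C : lmodType R) (f : {linear A -> B})
    (g : {linear B -> C}) (h : {linear A -> C}) :
  (forall x, h x = g (f x)) ->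
  forall z, tensor_map F h z = tensor_map F g (tensor_map F f z).
Proof.
move=> hE; apply: (tensor_hom_ext (h := tensor_map F g \o tensor_map F f)).
by move=> x m; rewrite tensor_map_tens hE -2!tensor_map_tens.
Qed.

Lemma tensor_map_eq0 (A B : lmodType R) (f : {linear A -> B}) :
  (forall x, f x = 0) -> forall z, tensor_map F f z = 0.
Proof.
move=> f0; apply: (tensor_hom_ext (h := \0)) => x m.
by rewrite tensor_map_tens f0 tens0r.
Qed.

Lemma tensor_map_id (A : lmodType R) (z : tensor F A) :
  tensor_map F idfun z = z.
Proof.
by apply: (tensor_hom_ext (h := idfun)) z => x m; rewrite tensor_map_tens.
Qed.

Lemma tensor_map_scale (A : lmodType R) (r : R) (z : tensor F A) :
  tensor_map F ( *:%R r) z = r *: z.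
Proof.
apply: (tensor_hom_ext (h := *:%R r)) z => x m; rewrite tensor_map_tens /=.
have [_ tr] := @tens_bilin R F A.
by have := tr x r m 0; rewrite tens0r !addr0.
Qed.

Variable M : lmodType R.
Implicit Types K L N P : submodClosed M.

Lemma quot_pi_eq0 L m : quot_pi L m = 0 <-> m \in L.
Proof. by rewrite -(linear0 (quot_pi L)) quot_piP subr0. Qed.

(** Flatness keeps K -> A -> B exact at A. Since [g] is any map with kernel [K], membership in F (x)
    K becomes an equation in a convenient target. *)
Lemma mem_tensor_ker (A B : lmodType R) (K : submodClosed A)
    (g : {linear A -> B}) :
  flat F -> (forall x, g x = 0 <-> x \in K) ->
  forall z, z \in tensor_submod F K <-> tensor_map F g z = 0.
Proof.
move=> flatF kerg z.
have -> : tensor_map F g z = 0 <-> exists w, tensor_map F (submod_incl K) w = z.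
  apply: flatF => x; rewrite kerg; split=> [Kx|[y <-]].
    by exists (SubmodElt Kx).
  exact: submod_valP.
by split=> [/image_submodP|?] //; apply/image_submodP.
Qed.

(** The preimage is the kernel of A -> M -> M/L, so both sides say that [z] dies in F (x) M/L. *)
Lemma mem_tensor_preim (A : lmodType R) (f : {linear A -> M}) L z :
  flat F ->
  z \in tensor_submod F (preim_submod f L) <->
  tensor_map F f z \in tensor_submod F L.
Proof.
move=> flatF; rewrite (mem_tensor_ker flatF (quot_pi_eq0 L)).
rewrite -(tensor_map_comp (h := quot_pi L \o f)) //.
by apply: mem_tensor_ker => // x; exact: quot_pi_eq0.
Qed.

Lemma mem_tensor_colon L r z :
  flat F ->
  z \in tensor_submod F (colon L r) <-> r *: z \in tensor_submod F L.
Proof. by move=> flatF; rewrite mem_tensor_preim // tensor_map_scale. Qed.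

Lemma tensor_submodS K L :
  flat F -> (forall m, m \in K -> m \in L) ->
  forall z, z \in tensor_submod F K -> z \in tensor_submod F L.
Proof.
move=> flatF sKL _ /image_submodP[w <-].
apply/(mem_tensor_ker flatF (quot_pi_eq0 L)).
(* The composite K -> M -> M/L is zero, and stays zero after tensoring. *)
rewrite -(tensor_map_comp (h := quot_pi L \o submod_incl K)) //.
apply: tensor_map_eq0 => x /=.
by apply/quot_pi_eq0/sKL; exact: submod_valP.
Qed.

(** * Descent along a faithfully flat F *)

Lemma faithfully_flat_flat : faithfully_flat F -> flat F.
Proof. by move=> ffF A B C f g /ffF. Qed.

(** K lies in L exactly when [f] : K -> M/L vanishes. The hypothesis gives this after tensoring, and
    faithful flatness reflects it. *)
Lemma tensor_submodS_inv K L :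
  faithfully_flat F ->
  (forall z, z \in tensor_submod F K -> z \in tensor_submod F L) ->
  forall m, m \in K -> m \in L.
Proof.
move=> ffF sKL m Km; have flatF := faithfully_flat_flat ffF.
pose f : {linear submod_type K -> quot_mod L} := quot_pi L \o submod_incl K.
have f0 w : tensor_map F f w = 0.
  rewrite (tensor_map_comp (f := submod_incl K) (g := quot_pi L)) //.
  apply/(mem_tensor_ker flatF (quot_pi_eq0 L)).
  by apply: sKL; apply/image_submodP; exists w.
(* K -> M/L vanishes iff K -> M/L -> M/L, ending with the identity, is exact. *)
have : exact_seq f (idfun : {linear quot_mod L -> quot_mod L}).
  apply/ffF => z; rewrite tensor_map_id.
  by split=> [->|[w <-]]; [exists 0; rewrite linear0|exact: f0].
move=> /(_ (quot_pi L m))[_ exf]; apply/quot_pi_eq0/exf.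
by exists (SubmodElt Km).
Qed.

Lemma proper_tensor_submod L :
  faithfully_flat F -> proper_submod L -> proper_submod (tensor_submod F L).
Proof.
move=> ffF properL allL; apply: properL => m.
(* (L : 0) is the whole of M. *)
apply: (@tensor_submodS_inv (colon L 0) L ffF); first by move=> z _.
by rewrite mem_colon scale0r rpred0.
Qed.

(** With [P] and [s] free, this serves all alternatives of the criterion: (phi N : abc), (N : ab)
    and (N : c). *)
Lemma tensor_colonS N P r s :
  flat F -> (forall m, r *: m \in N -> s *: m \in P) ->
  forall z, r *: z \in tensor_submod F N -> s *: z \in tensor_submod F P.
Proof.
move=> flatF sNP z; rewrite -!mem_tensor_colon //.
exact: (@tensor_submodS (colon N r) (colon P s)).
Qed.

Lemma tensor_colonS_inv N P r s :
  faithfully_flat F ->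
  (forall z, r *: z \in tensor_submod F N -> s *: z \in tensor_submod F P) ->
  forall m, r *: m \in N -> s *: m \in P.
Proof.
move=> ffF sNP; apply: (@tensor_submodS_inv (colon N r) (colon P s)) => // z.
rewrite !mem_tensor_colon //; try exact: faithfully_flat_flat.
exact: sNP.
Qed.

Lemma tensor_colon_opt N (o : option (submodClosed M)) r :
  flat F -> (forall m, r *: m \in N -> in_opt o (r *: m)) ->
  forall z, r *: z \in tensor_submod F N ->
    in_opt (omap (tensor_submod F) o) (r *: z).
Proof.
case: o => [P|] flatF sNo; first exact: tensor_colonS.
(* If [o] is empty, the hypothesis already fails at 0, which lies in [N] but not in the empty
   set. *)
by have := sNo 0; rewrite scaler0 rpred0 => /(_ isT).
Qed.

Lemma tensor_colon_opt_inv N (o : option (submodClosed M)) r :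
  faithfully_flat F ->
  (forall z, r *: z \in tensor_submod F N ->
    in_opt (omap (tensor_submod F) o) (r *: z)) ->
  forall m, r *: m \in N -> in_opt o (r *: m).
Proof.
case: o => [P|] ffF sNo; first exact: tensor_colonS_inv.
by have := sNo 0; rewrite scaler0 rpred0 => /(_ isT).
Qed.

End TensorSubmodules.

Theorem theorem8 (R : comUnitRingType) (hR : um_ring R) (M F : lmodType R)
  (phi : submodClosed M -> option (submodClosed M))
  (phit : submodClosed (tensor F M) -> option (submodClosed (tensor F M)))
  (hphi : contracting phi) (hphit : contracting phit)
  (N : submodClosed M) (hN : proper_submod N)
  (hFN : omap (tensor_submod F) (phi N) = phit (tensor_submod F N)) :
  (flat F -> classical_1abs_prime phi N -> proper_submod (tensor_submod F N) ->
     classical_1abs_prime phit (tensor_submod F N)) /\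
  (faithfully_flat F ->
     (classical_1abs_prime phi N <-> classical_1abs_prime phit (tensor_submod F N))).
Proof.
have direct : flat F -> classical_1abs_prime phi N ->
    proper_submod (tensor_submod F N) ->
    classical_1abs_prime phit (tensor_submod F N).
  move=> flatF /(classical_1abs_primeP _ _ hR)[_ primeN] properFN.
  (* [hFN] replaces the value of [phit] by F (x) phi N, so each alternative for [N] has its tensored
     counterpart. *)
  apply/(classical_1abs_primeP _ _ hR); split=> // a b c ua ub uc; rewrite -hFN.
  have [sN|sN|sN] := primeN a b c ua ub uc.
  - by constructor 1; exact: tensor_colon_opt.
  - by constructor 2; exact: tensor_colonS.
  - by constructor 3; exact: tensor_colonS.
split=> // ffF; split=> [primeN|].
  (* A faithfully flat F is flat and keeps F (x) N proper, so this half is an instance of (1). *)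
  by apply: direct => //; [exact: faithfully_flat_flat|exact: proper_tensor_submod].
move=> /(classical_1abs_primeP _ _ hR)[_ primeFN].
apply/(classical_1abs_primeP _ _ hR); split=> // a b c ua ub uc.
have := primeFN a b c ua ub uc; rewrite -hFN => -[sN|sN|sN].
- by constructor 1; exact: tensor_colon_opt_inv sN.
- by constructor 2; exact: tensor_colonS_inv sN.
- by constructor 3; exact: tensor_colonS_inv sN.
Qed.
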